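(* $(\mathfrak g_4,S_A,J)$ is a first kind algebraic Ricci soliton associated to $\nabla^1$ (that is, there exist $c\in\mathbb R$ and a derivation $D$ of $\mathfrak g_4$ with $\operatorname{Ric}^1=c\operatorname{Id}+D$) if and only if $\alpha=\nu=0$. In this case, in the basis $\{v_1,v_2,v_3,v_4\}$, $$\operatorname{Ric}^1=\begin{bmatrix}0&0&0&0\\0&0&0&0\\0&-\frac1\beta&0&0\\0&0&0&0\end{bmatrix},$$ and $\operatorname{Ric}^1$ is a derivation of $\mathfrak g_4$.
   Context: $\mathfrak g_4$ is the real Lie algebra with basis $e_1,e_2,e_3,e_4$ and non-zero brackets (up to skew-symmetry) $[e_1,e_2]=e_3$, $[e_1,e_3]=e_4$. $S_A$ is the Lorentzian inner product $\langle\cdot,\cdot\rangle$ on $\mathfrak g_4$ whose matrix in $(e_1,e_2,e_3,e_4)$ is $\begin{bmatrix}1&0&0&0\\0&1&0&0\\0&0&a&b\\0&0&b&c_0\end{bmatrix}$, where $A=\begin{bmatrix}a&b\\ b&c_0\end{bmatrix}$ is a real symmetric matrix of Lorentzian signature ($\det A<0$). Fix real numbers $\alpha,\beta,\mu,\nu$ such that $v_1=e_1$, $v_2=e_2$, $v_3=\alpha e_3+\beta e_4$, $v_4=\mu e_3+\nu e_4$ is an orthonormal basis for $S_A$: $\langle v_i,v_j\rangle=0$ for $i\ne j$, $\langle v_i,v_i\rangle=1$ for $i=1,2,3$, $\langle v_4,v_4\rangle=-1$ (so $\alpha\nu-\beta\mu\neq0$). The product structure $J$ is the linear map with $Jv_i=v_i$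 for $i=1,2,3$ and $Jv_4=-v_4$. Write $\mathfrak g$ for the Lie algebra. The Levi-Civita connection is the bilinear map $\nabla:\mathfrak g\times\mathfrak g\to\mathfrak g$ with $2\langle\nabla_uv,w\rangle=\langle[u,v],w\rangle+\langle[w,u],v\rangle+\langle[w,v],u\rangle$ for all $u,v,w$. Put $(\nabla_uJ)v=\nabla_u(Jv)-J(\nabla_uv)$. The canonical connection is $\nabla^0_uv=\nabla_uv-\frac12(\nabla_uJ)Jv$, and the Kobayashi-Nomizu connection is $\nabla^1_uv=\nabla^0_uv-\frac14\left[(\nabla_vJ)Ju-(\nabla_{Jv}J)u\right]$. The curvature of $\nabla^1$ is $R^1_{uv}w=\nabla^1_{[u,v]}w-\nabla^1_u\nabla^1_vw+\nabla^1_v\nabla^1_uw$, and its Ricci operator is $\operatorname{Ric}^1(u)=\sum_{k=1}^4\langle v_k,v_k\rangle R^1_{v_ku}v_k$. A derivation of $\mathfrak g$ is a linear map $D:\mathfrak g\to\mathfrak g$ with $[D(u),v]+[u,D(v)]=D[u,v]$ for all $u,v\in\mathfrak g$. In matrices, the $j$-th column contains the coordinates of the image of $v_j$ in the basis $(v_1,v_2,v_3,v_4)$. *)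

(* Defs.v *)
From HB Require Import structures.
From mathcomp Require Import all_boot all_order all_algebra reals.
From mathcomp Require Import ring lra.

Set Implicit Arguments.
Unset Strict Implicit.
Unset Printing Implicit Defensive.

Import GRing.Theory Num.Theory.
Local Open Scope ring_scope.

Section MetricLieAlgebra.

Variables (R : realType) (V : lmodType R).
Variables (br : V -> V -> V) (ip : V -> V -> R).

Definition is_lie_bracket : Prop :=
  [/\ forall w, linear (br^~ w), forall u, linear (br u),
      forall u, br u u = 0
    & forall u v w, br u (br v w) + br v (br w u) + br w (br u v) = 0].

Definition is_derivation (D : V -> V) : Prop :=
  linear D /\ forall u v, br (D u) v + br u (D v) = D (br u v).

(* Koszul formula. *)
Definition is_levi_civita (nabla : {bilinear V -> V -> V}) : Prop :=
  forall u v w,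
    2 * ip (nabla u v) w =
      ip (br u v) w + ip (br w u) v + ip (br w v) u.

(* [covJ nabla J u v] is (\nabla_u J) v. *)
Definition covJ (nabla : V -> V -> V) (J : V -> V) (u v : V) : V :=
  nabla u (J v) - J (nabla u v).

Definition canonical_connection (nabla : V -> V -> V) (J : V -> V)
    (u v : V) : V :=
  nabla u v - 2^-1 *: covJ nabla J u (J v).

Definition kobayashi_nomizu (nabla : V -> V -> V) (J : V -> V)
    (u v : V) : V :=
  canonical_connection nabla J u v
    - 4^-1 *: (covJ nabla J v (J u) - covJ nabla J (J v) u).

(* The sign convention is R_{uv} = \nabla_[u,v] - [\nabla_u, \nabla_v]. *)
Definition curvature (nabla : V -> V -> V) (u v w : V) : V :=
  nabla (br u v) w - nabla u (nabla v w) + nabla v (nabla u w).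

Definition ricci (nabla : V -> V -> V) (n : nat) (f : 'I_n -> V) (u : V) : V :=
  \sum_(k < n) ip (f k) (f k) *: curvature nabla (f k) u (f k).

Definition first_kind_soliton (Ric : V -> V) : Prop :=
  exists (c : R) (D : V -> V),
    is_derivation D /\ forall u, Ric u = c *: u + D u.

(* The j-th column of M holds the coordinates of F (f j). *)
Definition has_matrix (n : nat) (f : 'I_n -> V) (F : V -> V) (M : 'M[R]_n) :
  Prop := forall j, F (f j) = \sum_i M i j *: f i.

End MetricLieAlgebra.

(* The Lie algebra g_4: a vector is the column of its coordinates in
   (e_1, e_2, e_3, e_4). Indices start at 0, so that e_k is [basis4 (k - 1)]. *)
Section G4.

Variable R : realType.
Local Notation g4 := 'cV[R]_4.

Definition basis4 (i : 'I_4) : g4 := delta_mx i 0.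

Definition br4 (u v : g4) : g4 :=
  (u 0 0 * v 1 0 - u 1 0 * v 0 0) *: basis4 2
    + (u 0 0 * v 2 0 - u 2 0 * v 0 0) *: basis4 3.

Definition gram4 (A : 'M[R]_2) : 'M[R]_4 :=
  block_mx (1%:M : 'M_(2, 2)) 0 0 A.

Definition ip4 (A : 'M[R]_2) (u v : g4) : R := (u^T *m gram4 A *m v) 0 0.

Definition frame4 (alpha beta mu nu : R) : 'I_4 -> g4 :=
  tnth [tuple basis4 0; basis4 1; alpha *: basis4 2 + beta *: basis4 3;
              mu *: basis4 2 + nu *: basis4 3].

(* Both the causal characters <v_i, v_i> and the eigenvalues of J. *)
Definition eps4 (i : 'I_4) : R := if i == 3 then -1 else 1.

Definition orthonormal4 (A : 'M[R]_2) (f : 'I_4 -> g4) : Prop :=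
  forall i j, ip4 A (f i) (f j) = if i == j then eps4 i else 0.


Lemma br4_e1e2 : br4 (basis4 0) (basis4 1) = basis4 2.
Proof.
by rewrite /br4 !mxE /= !(mulr0, mulr1, subr0) scale1r scale0r addr0.
Qed.

Lemma br4_e1e3 : br4 (basis4 0) (basis4 2) = basis4 3.
Proof.
by rewrite /br4 !mxE /= !(mulr0, mulr1, subr0) scale1r scale0r add0r.
Qed.

Lemma br4_linl w : linear (br4^~ w).
Proof. by move=> a u v; apply/colP=> i; rewrite !mxE; ring. Qed.

Lemma br4_linr u : linear (br4 u).
Proof. by move=> a v w; apply/colP=> i; rewrite !mxE; ring. Qed.

Lemma br4_lie : is_lie_bracket br4.
Proof.
split; [exact: br4_linl | exact: br4_linr | move=> u | move=> u v w].
  by apply/colP=> i; rewrite !mxE; ring.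
by apply/colP=> i; rewrite !mxE /=; ring.
Qed.

(* Existence of the Levi-Civita connection of S_A. *)
Section LeviCivita.

Variable A : 'M[R]_2.

Lemma ip4_linl w a u v : ip4 A (a *: u + v) w = a * ip4 A u w + ip4 A v w.
Proof. by rewrite /ip4 linearP /= !mulmxDl -!scalemxAl !mxE. Qed.

Lemma ip4_linr w a u v : ip4 A w (a *: u + v) = a * ip4 A w u + ip4 A w v.
Proof. by rewrite /ip4 mulmxDr -scalemxAr !mxE. Qed.

Definition koszul4 (u v w : g4) : R :=
  2^-1 * (ip4 A (br4 u v) w + ip4 A (br4 w u) v + ip4 A (br4 w v) u).

Lemma koszul4_linr u v : scalar (koszul4 u v).
Proof.
move=> a w w'; rewrite /koszul4 !br4_linl !(ip4_linl, ip4_linr) /=; ring.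
Qed.

HB.instance Definition _ u v :=
  GRing.isLinear.Build R g4 R _ (koszul4 u v) (koszul4_linr u v).

Definition levi_civita4 (u v : g4) : g4 :=
  invmx (gram4 A) *m \col_k koszul4 u v (basis4 k).

Lemma levi_civita4_bilinear :
  ((forall w, linear (levi_civita4^~ w)) *
   (forall u, linear (levi_civita4 u)))%type.
Proof.
split=> [w|u] a x y; rewrite /= /levi_civita4 scalemxAr -mulmxDr;
  congr (_ *m _); apply/colP=> k; rewrite !mxE /koszul4.
- by rewrite br4_linl br4_linr !(ip4_linl, ip4_linr) /=; ring.
- by rewrite !br4_linr !(ip4_linl, ip4_linr) /=; ring.
Qed.

HB.instance Definition _ :=
  bilinear_isBilinear.Build R g4 g4 g4 *:%R *:%R levi_civita4
    levi_civita4_bilinear.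

Lemma levi_civita4P : A^T = A -> \det A != 0 ->
  is_levi_civita br4 (ip4 A) levi_civita4.
Proof.
move=> symA detA u v w.
have symG : (gram4 A)^T = gram4 A.
  by rewrite /gram4 (@tr_block_mx _ 2 2 2 2) !trmx0 trmx1 symA.
have unitG : gram4 A \in unitmx.
  by rewrite unitmxE /gram4 (@det_ublock _ 2 2) det1 mul1r unitfE.
suff -> : ip4 A (levi_civita4 u v) w = koszul4 u v w.
  by rewrite /koszul4 mulrA divff ?mul1r // pnatr_eq0.
rewrite /ip4 /levi_civita4 trmx_mul trmx_inv symG mulmxKV // mxE.
have {2}-> : w = \sum_k w k 0 *: basis4 k.
  apply/colP=> i; rewrite summxE (bigD1 i) //= big1 ?addr0 => [|j ji].
    by rewrite !mxE !eqxx mulr1.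
  by rewrite !mxE eq_sym (negPf ji) mulr0.
rewrite linear_sum; apply: eq_bigr => k _.
by rewrite linearZ /= !mxE mulrC.
Qed.

End LeviCivita.
End G4.

(* Main.v *)
Require Import Defs.
From mathcomp Require Import all_boot all_order all_algebra reals.
From mathcomp Require Import ring lra.

Set Implicit Arguments.
Unset Strict Implicit.
Unset Printing Implicit Defensive.

Import GRing.Theory Num.Theory.
Local Open Scope ring_scope.

(* In the frame (v_i) the algebra is the semidirect product of R v_1 with an
   abelian ideal: [v_1,v_2] = p v_3 + q v_4, [v_1,v_3] = r v_3 + s v_4,
   [v_1,v_4] = t v_3 + w v_4, where w = -r, s t = -r^2 and
   p r + q t = -mu/Delta, Delta = alpha nu - beta mu.  The Koszul formula and the
   definition of nabla^1 express Ric^1 as a polynomial in the structure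
   constants.  If D = Ric^1 - c Id is a derivation, its v_2-coordinate at
   (v_1,v_2) gives p (p r + q t) = 0, i.e. p mu = 0.  When mu = 0 we get
   r = t = 0, then c s = 0 forces c = 0 and p^3 = 0, which is absurd; so p = 0,
   i.e. nu = 0, and then c q = 0 forces c = 0 and r^3 = 0, i.e. alpha = 0. *)

(** * Linear combinations of a family of vectors *)

Lemma linear_comb (R : nzRingType) (V W : lmodType R) m (f : 'I_m -> V)
    (F : V -> W) : linear F ->
  forall c : 'I_m -> R, F (\sum_k c k *: f k) = \sum_k c k *: F (f k).
Proof.
move=> linF c.
have F0 : F 0 = 0.
  by have := linF (-1) 0 0; rewrite scaler0 addr0 scaleN1r addNr.
by elim/big_rec2: _ => [//|k y x _ Fx]; rewrite linF Fx.
Qed.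

Lemma comb_comb (R : nzRingType) (V : lmodType R) m n (f : 'I_m -> V)
    (a : 'I_n -> R) (b : 'I_n -> 'I_m -> R) :
  \sum_l a l *: (\sum_i b l i *: f i) = \sum_i (\sum_l a l * b l i) *: f i.
Proof.
under eq_bigr do rewrite scaler_sumr.
rewrite exchange_big /=; apply: eq_bigr => i _; rewrite scaler_suml.
by apply: eq_bigr => l _; rewrite scalerA.
Qed.

(** * The Ricci operator of nabla^1 in an orthonormal frame of eigenvectors of J *)

Section KobayashiNomizu.

Variables (R : realType) (n : nat).
Local Notation V := 'cV[R]_n.
Variables (J : {linear V -> V}) (nabla : {bilinear V -> V -> V}).
Local Notation KN := (kobayashi_nomizu nabla J).

Lemma kobayashi_nomizu_linl w : linear (KN^~ w).
Proof.
move=> a u v; rewrite /kobayashi_nomizu /canonical_connection /covJ.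
rewrite !(linearPl, linearPr, linearP) /=.
by apply/colP=> i; rewrite !mxE; ring.
Qed.

Lemma kobayashi_nomizu_linr u : linear (KN u).
Proof.
move=> a v w; rewrite /kobayashi_nomizu /canonical_connection /covJ.
rewrite !(linearPl, linearPr, linearP) /=.
by apply/colP=> i; rewrite !mxE; ring.
Qed.

Variables (br : V -> V -> V) (ip : V -> V -> R).

Lemma ricci_linear m (f : 'I_m -> V) :
  (forall u, linear (br u)) -> linear (ricci br ip KN f).
Proof.
move=> br_linr a u v; rewrite /ricci scaler_sumr -big_split /=.
apply: eq_bigr => k _; rewrite /curvature.
rewrite !(br_linr, kobayashi_nomizu_linl, kobayashi_nomizu_linr).
(* Generalizing keeps [mxE] from unfolding the connection. *)
move: (ip _ _) => c.
do ![move: (kobayashi_nomizu _ _ _ _) => ?].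
by apply/colP=> i; rewrite !mxE; ring.
Qed.

Variables (m : nat) (f : 'I_m -> V) (e : 'I_m -> R).
Variable C : 'I_m -> 'I_m -> 'I_m -> R.

Hypothesis nablaP : is_levi_civita br ip nabla.
Hypothesis Jf : forall i, J (f i) = e i *: f i.
Hypothesis e2 : forall i, e i * e i = 1.
Hypothesis expand : forall x, x = \sum_k (e k * ip x (f k)) *: f k.
Hypothesis ipC : forall i j k, ip (br (f i) (f j)) (f k) = e k * C i j k.

(** Koszul formula in the frame: the factor [e k] from [expand] cancels the one in front of
    [C i j k], because [e k] is its own inverse. *)
Definition christoffel i j k : R :=
  2^-1 * (C i j k + e k * (e j * C k i j + e i * C k j i)).

Lemma levi_civita_frame i j :
  nabla (f i) (f j) = \sum_k christoffel i j k *: f k.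
Proof.
rewrite [LHS]expand; apply: eq_bigr => k _; congr (_ *: _).
have := nablaP (f i) (f j) (f k); rewrite !ipC /christoffel.
move=> h; have -> : ip (nabla (f i) (f j)) (f k) =
    2^-1 * (e k * C i j k + e j * C k i j + e i * C k j i).
  by rewrite -h; field.
have {2}-> : C i j k = e k * e k * C i j k by rewrite e2 mul1r.
by ring.
Qed.

(* Since [f i] is an eigenvector of J, (\nabla_u J) (f i) = (e i - J) \nabla_u (f i),
   whose f_k-component is the one of \nabla_u (f i) scaled by e i - e k. *)
Definition kn_symbol i j k : R :=
  2^-1 * (1 + e j * e k) * christoffel i j k
    - 4^-1 * (e i - e j) * (e i - e k) * christoffel j i k.

(** The canonical part projects nabla_(f i) (f j) onto the eigenspace of J containing [f j]; the
    correction term occurs only when [e i] and [e j] are opposite. *)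
Lemma kobayashi_nomizu_eigen i j :
  KN (f i) (f j) =
    2^-1 *: (nabla (f i) (f j) + e j *: J (nabla (f i) (f j)))
    - (4^-1 * (e i - e j)) *:
        (e i *: nabla (f j) (f i) - J (nabla (f j) (f i))).
Proof.
rewrite /kobayashi_nomizu /canonical_connection /covJ !(Jf, linearZ) /=.
rewrite !linearZl_LR /= !linearZ /=.
move: (nabla (f i) (f j)) (nabla (f j) (f i)) => X Y.
move: (J X) (J Y) (e2 j) => JX JY ej2.
apply/colP => l; rewrite !mxE.
by field: ej2.
Qed.

Lemma kobayashi_nomizu_frame i j :
  KN (f i) (f j) = \sum_k kn_symbol i j k *: f k.
Proof.
have JE i' j' :
    J (nabla (f i') (f j')) = \sum_k (christoffel i' j' k * e k) *: f k.
  rewrite levi_civita_frame linear_sum; apply: eq_bigr => k _.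
  by rewrite linearZ /= Jf scalerA.
rewrite kobayashi_nomizu_eigen !JE !levi_civita_frame.
rewrite !scaler_sumr -big_split -sumrB !scaler_sumr -sumrB.
apply: eq_bigr => k _; rewrite /kn_symbol.
by apply/colP => l; rewrite !mxE; ring.
Qed.

Hypothesis brf : forall i j, br (f i) (f j) = \sum_k C i j k *: f k.
Hypothesis ipf : forall i, ip (f i) (f i) = e i.

(** Row [i], column [j]; the three products come from the three terms of the curvature R_(f_k f_j)
    f_k. *)
Definition ricci_symbol i j : R :=
  \sum_k e k * \sum_l (C k j l * kn_symbol l k i
    - kn_symbol j k l * kn_symbol k l i + kn_symbol k k l * kn_symbol j l i).

Lemma ricci_frame j : ricci br ip KN f (f j) = \sum_i ricci_symbol i j *: f i.
Proof.
have sumE u c := linear_comb f (kobayashi_nomizu_linr u) c.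
have sumEl u c := linear_comb f (kobayashi_nomizu_linl u) c.
rewrite /ricci_symbol -comb_comb; apply: eq_bigr => k _.
rewrite ipf; congr (_ *: _).
rewrite /curvature brf !kobayashi_nomizu_frame !(sumE, sumEl).
under eq_bigr do rewrite kobayashi_nomizu_frame.
under [X in _ - X]eq_bigr do rewrite kobayashi_nomizu_frame.
under [X in _ + X]eq_bigr do rewrite kobayashi_nomizu_frame.
rewrite !comb_comb -sumrB -big_split /=; apply: eq_bigr => i _.
by rewrite -scalerBl -scalerDl -sumrB -big_split.
Qed.

End KobayashiNomizu.

(** * The frame (v_i) of g_4 and its structure constants *)

Lemma sum_ord4 (M : nmodType) (F : 'I_4 -> M) :
  \sum_k F k = F 0 + F 1 + F 2 + F 3.
Proof.
rewrite !big_ord_recl big_ord0 addr0 !addrA.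
by congr (_ + F _ + F _ + F _); apply: val_inj.
Qed.

Lemma ord4_case (P : 'I_4 -> Prop) : P 0 -> P 1 -> P 2 -> P 3 -> forall i, P i.
Proof.
move=> P0 P1 P2 P3 [[|[|[|[|//]]]] lti].
- by rewrite (_ : Ordinal lti = 0) //; apply: val_inj.
- by rewrite (_ : Ordinal lti = 1) //; apply: val_inj.
- by rewrite (_ : Ordinal lti = 2) //; apply: val_inj.
- by rewrite (_ : Ordinal lti = 3) //; apply: val_inj.
Qed.

(* [v_i, v_j] = \sum_k struct4 i j k v_k; all brackets not involving v_0 vanish
   (indices start at 0), and a list that is too short reads as 0 beyond its end. *)
Definition struct4 (R : realType) (p q r s t w : R) (i j k : 'I_4) : R :=
  let ad0 (j k : 'I_4) :=
    (nth [::] [:: [::]; [:: 0; 0; p; q]; [:: 0; 0; r; s]; [:: 0; 0; t; w]]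
       j)`_k in
  if i == 0 then ad0 j k else if j == 0 then - ad0 i k else 0.

(** Obtained from e_3 = (nu v_3 - beta v_4) / delta and e_4 = (alpha v_4 - mu v_3) / delta. *)
Definition frame4_struct (R : realType) (alpha beta mu nu : R) :=
  let delta := alpha * nu - beta * mu in
  struct4 (nu / delta) (- (beta / delta)) (- (alpha * mu / delta))
    (alpha ^+ 2 / delta) (- (mu ^+ 2 / delta)) (alpha * mu / delta).

Section AdaptedFrame.

Variables (R : realType) (A : 'M[R]_2) (alpha beta mu nu : R).
Local Notation v := (frame4 alpha beta mu nu).
Local Notation e := (eps4 R).
Local Notation ip := (ip4 A).

Hypothesis ortho : orthonormal4 A v.

Local Notation delta := (alpha * nu - beta * mu).

Lemma eps4_sq i : e i * e i = 1.
Proof. by rewrite /eps4; case: ifP => _; ring. Qed.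

Lemma ip4_suml n (c : 'I_n -> R) (f : 'I_n -> 'cV[R]_4) x :
  ip (\sum_k c k *: f k) x = \sum_k c k * ip (f k) x.
Proof.
rewrite /ip4 linear_sum !mulmx_suml summxE; apply: eq_bigr => k _.
by rewrite linearZ /= -!scalemxAl mxE.
Qed.

Lemma ip4_frame (c : 'I_4 -> R) i : ip (\sum_k c k *: v k) (v i) = c i * e i.
Proof.
rewrite ip4_suml (bigD1 i) //= ortho eqxx big1 ?addr0 // => j ji.
by rewrite ortho (negPf ji) mulr0.
Qed.

Lemma frame4_inj (c d : 'I_4 -> R) :
  \sum_k c k *: v k = \sum_k d k *: v k -> c =1 d.
Proof.
move=> cd i; apply: (can_inj (mulrK (_ : e i \is a GRing.unit))).
  by apply/unitrP; exists (e i); rewrite eps4_sq.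
by rewrite -!ip4_frame cd.
Qed.

(** A zero determinant would give the relations nu v_3 = beta v_4 and mu v_3 = alpha v_4;
    independence of the frame makes these coefficients vanish, so v_3 = 0, which is absurd. *)
Lemma frame4_det_neq0 : delta != 0.
Proof.
apply/eqP => d0.
have {}d0 : alpha * nu = beta * mu by apply/eqP; rewrite -subr_eq0 d0.
have dep c d : c * alpha = - (d * mu) -> c * beta = - (d * nu) -> c = 0 /\ d = 0.
  move=> h2 h3.
  have h : \sum_(k < 4) [:: 0; 0; c; d]`_k *: v k = \sum_k 0 *: v k.
    rewrite !sum_ord4; apply/colP; apply: ord4_case;
      rewrite !mxE /= !(mulr0, mulr1, mul0r, addr0, add0r) //.
      by rewrite h2 addNr.
    by rewrite h3 addNr.
  by have := frame4_inj h => h'; split; [exact: h' 2 | exact: h' 3].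
have [] := dep nu (- beta); [ring: d0 | ring | move=> nu0 /eqP].
rewrite oppr_eq0 => /eqP beta0.
have [] := dep 1 0; rewrite ?beta0; [| ring | move/eqP; by rewrite oner_eq0].
have [] := dep mu (- alpha); [ring | ring: d0 | move=> mu0 /eqP].
by rewrite oppr_eq0 => /eqP ->; ring.
Qed.

Lemma frame4_coord (x : 'cV[R]_4) :
  x = \sum_(k < 4) ([:: x 0 0; x 1 0; (nu * x 2 0 - mu * x 3 0) / delta;
                       (alpha * x 3 0 - beta * x 2 0) / delta]`_k) *: v k.
Proof.
have := frame4_det_neq0; rewrite sum_ord4 => d0.
by apply/colP; apply: ord4_case; rewrite !mxE /=; field.
Qed.

Lemma frame4_expand x : x = \sum_k (e k * ip x (v k)) *: v k.
Proof.
rewrite [LHS]frame4_coord; apply: eq_bigr => k _; congr (_ *: _).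
by rewrite [in RHS](frame4_coord x) ip4_frame [RHS]mulrC -mulrA eps4_sq mulr1.
Qed.

Lemma br4_frame i j : br4 (v i) (v j) =
  \sum_k frame4_struct alpha beta mu nu i j k *: v k.
Proof.
have d0 := frame4_det_neq0; have [-> | i0] := eqVneq i 0.
  rewrite sum_ord4.
  by move: j; apply: ord4_case; apply/colP; apply: ord4_case;
    rewrite /frame4_struct /struct4 !mxE /=; field.
have v0 : forall k, k != 0 -> v k 0 0 = 0.
  by apply: ord4_case; rewrite // => _; rewrite !mxE /=; ring.
have [-> | j0] := eqVneq j 0.
  rewrite sum_ord4.
  by move: i i0; apply: ord4_case; rewrite // => _; apply/colP; apply: ord4_case;
    rewrite /frame4_struct /struct4 !mxE /=; field.
rewrite /br4 !v0 // !mul0r !mulr0 subrr !scale0r addr0 big1 // => k _.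
by rewrite /frame4_struct /struct4 (negPf i0) (negPf j0) scale0r.
Qed.

End AdaptedFrame.

(** * Symbols of nabla^1 and Ric^1 as polynomials in the structure constants *)

Section StructureConstants.

Variables (R : realType) (p q r s t w : R).
Local Notation C := (struct4 p q r s t w).
Local Notation e := (eps4 R).

(** Lists are nested in the order [i], [j], [k] and read as 0 beyond their end. As nabla^1 preserves
    the eigenspaces of J, no nonzero entry has exactly one of [j], [k] equal to 3. *)
Lemma kn_symbol4 i j k : kn_symbol e C i j k =
  (nth [::] (nth [::]
   [:: [:: [::]; [:: 0; 0; p / 2]; [:: 0; - (p / 2)]; [:: 0; 0; 0; w]];
       [:: [:: 0; 0; - (p / 2)]; [::]; [:: p / 2]];
       [:: [:: 0; - (p / 2); - r]; [:: p / 2]; [:: r]];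
       [:: [:: 0; 0; - t]]] i) j)`_k.
Proof.
rewrite /kn_symbol /christoffel.
by move: i j k; apply: ord4_case; apply: ord4_case; apply: ord4_case;
   rewrite /struct4 /eps4 /=; field.
Qed.

(** The table is listed by columns: the outer index is [j], the inner one [i]. *)
Lemma ricci_symbol4 i j : ricci_symbol e C i j =
  (nth [::]
    [:: [:: - (p ^+ 2 / 2) - r ^+ 2];
        [:: 0; - (p ^+ 2 / 2); - (p * r + q * t)];
        [:: 0; - (p * r); p ^+ 2 / 2 - r ^+ 2 - s * t];
        [:: 0; - (p * t); - (2 * r * t) - t * w]] j)`_i.
Proof.
rewrite /ricci_symbol.
under eq_bigr do under eq_bigr do rewrite !kn_symbol4.
by move: i j; apply: ord4_case; apply: ord4_case;
  rewrite !sum_ord4 /struct4 /eps4 /=; field.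
Qed.

End StructureConstants.

(** * Derivations in coordinates and the soliton equations *)

Lemma derivation_frame (R : realType) (V : lmodType R) (br : V -> V -> V)
    m (f : 'I_m -> V) (C : 'I_m -> 'I_m -> 'I_m -> R) (D : V -> V)
    (N : 'I_m -> 'I_m -> R) :
  is_lie_bracket br -> is_derivation br D ->
  (forall c d : 'I_m -> R,
     \sum_k c k *: f k = \sum_k d k *: f k -> c =1 d) ->
  (forall i j, br (f i) (f j) = \sum_k C i j k *: f k) ->
  (forall j, D (f j) = \sum_i N i j *: f i) ->
  forall i j k, \sum_l (N l i * C l j k + N l j * C i l k) =
                \sum_l C i j l * N k l.
Proof.
move=> [brl brr _ _] [Dl Dbr] f_free brf Df i j; apply: f_free.
have := Dbr (f i) (f j).
rewrite !Df brf (linear_comb _ (brl _)) (linear_comb _ (brr _)).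
rewrite (linear_comb _ Dl).
under eq_bigr do rewrite brf.
under [X in _ + X]eq_bigr do rewrite brf.
under [X in _ = X]eq_bigr do rewrite Df.
rewrite !comb_comb -big_split => <- /=.
by apply: eq_bigr => k _; rewrite -scalerDl -big_split.
Qed.

Lemma soliton_frame4_degenerate (R : realType) (alpha beta mu nu c : R) :
  alpha * nu - beta * mu != 0 ->
  let C := frame4_struct alpha beta mu nu in
  let N i j := ricci_symbol (eps4 R) C i j - c * (i == j)%:R in
  (forall j k, \sum_l (N l 0 * C l j k + N l j * C 0 l k) =
               \sum_l C 0 j l * N k l) ->
  alpha = 0 /\ nu = 0.
Proof.
set delta := alpha * nu - beta * mu; move=> d0 C N h.
pose p := nu / delta; pose q := - (beta / delta).
pose r := - (alpha * mu / delta); pose s := alpha ^+ 2 / delta.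
pose t := - (mu ^+ 2 / delta); pose w := alpha * mu / delta.
have CE : C = struct4 p q r s t w by [].
(* These are coordinates 2 to 4 of the identity at (v_1, v_2) and coordinates 3, 4 at (v_1, v_3);
   they come off the stack in reverse, [h1] being [h 1 1] and [h5] being [h 2 3]. *)
have := h 1 1; have := h 1 2; have := h 1 3; have := h 2 2; have := h 2 3.
have w_r : w = - r by rewrite /r opprK.
have st : s * t = - r ^+ 2 by rewrite /s /t /r; field.
have prqt : p * r + q * t = - (mu / delta).
  by rewrite /p /q /r /t /delta; field.
rewrite !sum_ord4 /N CE !ricci_symbol4 /struct4 /= w_r.
have e1 : p * alpha + q * mu = 1 by rewrite /p /q /delta; field.
have e2 : s * delta = alpha ^+ 2 by rewrite /s; field.
have e3 : p * delta = nu by rewrite /p; field.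
have e4 : r * delta = - (alpha * mu) by rewrite /r; field.
have e5 : t * delta = - mu ^+ 2 by rewrite /t; field.
(* From here the structure constants are unknowns bound only by the polynomial relations above. *)
clearbody p q r s t w; move=> h5 h4 h3 h2 h1.
have /eqP : p * mu = 0.
  have -> : mu = - (p * r + q * t) * delta by rewrite prqt; field.
  by rewrite mulrA [X in X * _](_ : _ = 0) ?mul0r //; lra.
rewrite mulf_eq0 => /orP[] /eqP z0.
  have nu0 : nu = 0 by rewrite -e3 z0 mul0r.
  move: e1; rewrite z0 mul0r add0r => qmu.
  have [q0 mu0] : q != 0 /\ mu != 0.
    by split; apply: contra_eqN qmu => /eqP ->;
      rewrite ?mul0r ?mulr0 eq_sym oner_eq0.
  have c0 : c = 0.
    apply: (mulIf q0); rewrite mul0r; rewrite z0 in h3.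
    (* [lra] treats monomials as atoms, so the needed multiple of s t = - r^2 is supplied by
       hand. *)
    have : q * (s * t + r ^+ 2) = 0 by rewrite st addNr mulr0.
    by lra.
  have /eqP : r ^+ 3 = 0.
    (* [h4] becomes - r^3 = - r s t, whose right side is r^3. *)
    rewrite z0 c0 in h4.
    have : r * (s * t + r ^+ 2) = 0 by rewrite st addNr mulr0.
    by lra.
  rewrite expf_eq0 /= => /eqP r0.
  move/eqP: e4; rewrite r0 mul0r eq_sym oppr_eq0 mulf_eq0 (negPf mu0) orbF.
  by move=> /eqP.
have r0 : r = 0 by apply: (mulIf d0); rewrite e4 z0; ring.
have t0 : t = 0 by apply: (mulIf d0); rewrite e5 z0; ring.
move: e1; rewrite z0 mulr0 addr0 => pal.
have [p0 al0] : p != 0 /\ alpha != 0.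
  by split; apply: contra_eqN pal => /eqP ->;
    rewrite ?mul0r ?mulr0 eq_sym oner_eq0.
have s0 : s != 0.
  by apply: contra_neq al0 => s0; apply/eqP; rewrite -sqrf_eq0 -e2 s0 mul0r.
have c0 : c = 0.
  apply: (mulIf s0); rewrite mul0r; rewrite r0 t0 in h5.
  by lra.
have /eqP : p ^+ 3 = 0.
  (* [h2] becomes - p^3 = p^3 / 2. *)
  rewrite r0 t0 c0 in h2.
  by lra.
by rewrite expf_eq0 (negPf p0).
Qed.

Theorem theorem3p27 (R : realType) (A : 'M[R]_2) (alpha beta mu nu : R)
    (J : {linear 'cV[R]_4 -> 'cV[R]_4})
    (nabla : {bilinear 'cV[R]_4 -> 'cV[R]_4 -> 'cV[R]_4}) :
  A^T = A ->
  \det A < 0 ->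
  let v := frame4 alpha beta mu nu in
  orthonormal4 A v ->
  (forall i, J (v i) = eps4 R i *: v i) ->
  is_levi_civita (@br4 R) (ip4 A) nabla ->
  let Ric1 := ricci (@br4 R) (ip4 A) (kobayashi_nomizu nabla J) v in
  (first_kind_soliton (@br4 R) Ric1 <-> alpha = 0 /\ nu = 0) /\
  (alpha = 0 /\ nu = 0 ->
     has_matrix v Ric1 (- (1 / beta) *: delta_mx 2 1) /\
     is_derivation (@br4 R) Ric1).
Proof.
move=> _ _ v ortho Jv LC Ric1.
have d0 := frame4_det_neq0 ortho.
have brv := br4_frame ortho; set C := frame4_struct _ _ _ _ in brv.
have ipC i j k : ip4 A (br4 (v i) (v j)) (v k) = eps4 R k * C i j k.
  by rewrite brv (ip4_frame ortho) mulrC.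
have ipv i : ip4 A (v i) (v i) = eps4 R i by rewrite ortho eqxx.
have RicE : forall j, Ric1 (v j) = \sum_i ricci_symbol (eps4 R) C i j *: v i :=
  ricci_frame LC Jv (@eps4_sq R) (frame4_expand ortho) ipC brv ipv.
have RicL : linear Ric1 by apply/ricci_linear/br4_linr.
(* Here v_3 = beta e_4, so sending v_2 to - v_3 / beta means sending e_2 to - e_4. *)
have degE : alpha = 0 /\ nu = 0 -> forall u, Ric1 u = - u 1 0 *: basis4 R 3.
  move=> [a0 n0] u.
  rewrite [in LHS](frame4_coord ortho u) (linear_comb _ RicL).
  under eq_bigr do rewrite RicE.
  move: d0; rewrite comb_comb !sum_ord4 /C /frame4_struct !ricci_symbol4.
  rewrite a0 n0 mul0r sub0r => d0 /=.
  have [b0 m0] : beta != 0 /\ mu != 0.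
    by apply/andP; move: d0; rewrite oppr_eq0 mulf_eq0 negb_or.
  by apply/colP; apply: ord4_case; rewrite !mxE /= ?a0 ?n0; field; rewrite b0 m0.
have Ric_der : alpha = 0 /\ nu = 0 -> is_derivation (@br4 R) Ric1.
  (* The image lies in the centre, spanned by e_4, and the derived algebra, spanned by e_3 and e_4,
     is killed: both sides vanish. *)
  move=> an0; split=> // x y; rewrite !(degE an0).
  by apply/colP; apply: ord4_case; rewrite !mxE /=; ring.
split; last first.
  move=> an0; split; last exact: Ric_der.
  have [a0 n0] := an0; move: d0; rewrite a0 n0 mul0r sub0r => d0.
  have b0 : beta != 0 by move: d0; rewrite oppr_eq0 mulf_eq0 => /norP[].
  apply: ord4_case; rewrite (degE an0) sum_ord4 !mxE /=;
    apply/colP; apply: ord4_case; rewrite !mxE /= ?a0 ?n0; by field.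
split=> [[c [D [derD RicD]]]|an0]; last first.
  exists 0, Ric1; split; first exact: Ric_der.
  by move=> u; rewrite scale0r add0r.
(* The matrix of D = Ric^1 - c Id in the frame. *)
pose N i j := ricci_symbol (eps4 R) C i j - c * (i == j)%:R.
apply: (soliton_frame4_degenerate d0 (c := c)) => j k.
have DE l : D (v l) = \sum_i N i l *: v i; last first.
  exact: (derivation_frame (br4_lie R) derD (frame4_inj ortho) brv DE).
have -> : D (v l) = Ric1 (v l) - c *: v l by rewrite RicD addrC addKr.
rewrite RicE; under [RHS]eq_bigr do rewrite scalerBl.
rewrite sumrB; congr (_ - _).
rewrite (bigD1 l) //= eqxx mulr1 big1 ?addr0 // => i il.
by rewrite (negPf il) mulr0 scale0r.
Qed.
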